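(* Let $(\mathbf c^k)_{k\in\mathbb N}$, $(\tilde{\mathbf c}^k)_{k\in\mathbb N}$ be generated by any one of the seven primal-dual splitting schemes PDS-I, ..., PDS-VII (listed in the context, with the stated condition on $\mathbf M,\mathbf\Gamma$). Let $B_1\subset\mathbb R^N$ and $B_2\subset\mathbb R^M$ be such that $B_1\times B_2$ is bounded. Then for every $k\ge1$ the primal-dual gap restricted to $B_1\times B_2$ satisfies $$\Psi_{B_1\times B_2}\Big(\frac1k\sum_{i=0}^{k-1}\tilde{\mathbf c}^i\Big)\le\frac1{2k}\sup_{\mathbf c\in B_1\times B_2}\big\|\mathbf c^0-\mathbf c\big\|_{\mathcal S}^2 .$$ Furthermore, $\Psi_{B_1\times B_2}\big(\frac1k\sum_{i=0}^{k-1}\tilde{\mathbf c}^i\big)\ge0$ if $B_1\times B_2$ contains a saddle point $\mathbf c^\star=(\mathbf x^\star,\mathbf p^\star)\in\mathrm{zer}\,\mathcal A$.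
   Context: Let $f:\mathbb R^N\to\mathbb R\cup\{+\infty\}$ and $g:\mathbb R^M\to\mathbb R\cup\{+\infty\}$ be proper, lower semicontinuous and convex, $g^*$ the Fenchel conjugate of $g$, and $\mathbf A:\mathbb R^N\to\mathbb R^M$ linear. Let $\mathcal L(\mathbf x,\mathbf p)=f(\mathbf x)+\langle\mathbf p,\mathbf A\mathbf x\rangle-g^*(\mathbf p)$. Write $\mathbf c=(\mathbf x,\mathbf p)\in\mathbb R^N\times\mathbb R^M$. The primal-dual gap restricted to $B_1\times B_2$ is $$\Psi_{B_1\times B_2}(\mathbf c)=\sup_{\mathbf p'\in B_2}\mathcal L(\mathbf x,\mathbf p')-\inf_{\mathbf x'\in B_1}\mathcal L(\mathbf x',\mathbf p).$$ $\mathbb S_{++}$ denotes symmetric positive definite matrices; $X\succ Y$ means $X-Y\in\mathbb S_{++}$; $\|\mathbf c\|_{\mathcal S}^2=\langle\mathbf c,\mathcal S\mathbf c\rangle$; $\mathbf I$ is the identity; $\mathrm{prox}_\varphi^{B}(\mathbf u)=\arg\min_{\mathbf w}\varphi(\mathbf w)+\frac12\|\mathbf w-\mathbf u\|_B^2$. Condition for all schemes: $\mathbf M\in\mathbb S_{++}$ ($N\times N$), $\mathbf\Gamma\in\mathbb S_{++}$ ($M\times M$), $\mathbf M\succ\mathbf A^\top\mathbf\Gamma^{-1}\mathbf A$ (equivalently $\mathbf\Gamma\succ\mathbf A\mathbf M^{-1}\mathbf A^\top$). Let $$\mathcal A=\begin{bmatrix}\partial f&\mathbf A^\top\\-\mathbf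 A&\partial g^*\end{bmatrix},\qquad\mathrm{zer}\,\mathcal A=\{\mathbf c:0\in\mathcal A\mathbf c\}.$$ Each scheme is a generalized proximal point algorithm $$0\in\mathcal A\tilde{\mathbf c}^k+\mathcal Q(\tilde{\mathbf c}^k-\mathbf c^k),\qquad\mathbf c^{k+1}=\mathbf c^k+\mathcal M(\tilde{\mathbf c}^k-\mathbf c^k),$$ where $\tilde{\mathbf c}^k=(\tilde{\mathbf x}^k,\tilde{\mathbf p}^k)$ is the proximal output, and $\mathcal S=\mathcal Q\mathcal M^{-1}$. The schemes: PDS-I: $\mathcal Q=\begin{bmatrix}\mathbf M&-\mathbf A^\top\\-\mathbf A&\mathbf\Gamma\end{bmatrix}$, $\mathcal M=\mathbf I$; i.e. $\mathbf x^{k+1}=\mathrm{prox}_f^{\mathbf M}(\mathbf x^k-\mathbf M^{-1}\mathbf A^\top\mathbf p^k)$, $\mathbf p^{k+1}=\mathrm{prox}_{g^*}^{\mathbf\Gamma}(\mathbf p^k+\mathbf\Gamma^{-1}\mathbf A(2\mathbf x^{k+1}-\mathbf x^k))$. PDS-II: $\mathcal Q=\begin{bmatrix}\mathbf M&\mathbf A^\top\\\mathbf A&\mathbf\Gamma\end{bmatrix}$, $\mathcal M=\mathbf I$; i.e. $\mathbf p^{k+1}=\mathrm{prox}_{g^*}^{\mathbf\Gamma}(\mathbf p^k+\mathbf\Gamma^{-1}\mathbf A\mathbf x^k)$, $\mathbf x^{k+1}=\mathrm{prox}_f^{\mathbf M}(\mathbf x^k-\mathbf M^{-1}\mathbf A^\top(2\mathbf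 p^{k+1}-\mathbf p^k))$. PDS-III: $\mathcal Q=\begin{bmatrix}\mathbf M&0\\\mathbf A&\mathbf\Gamma\end{bmatrix}$, $\mathcal M=\begin{bmatrix}\mathbf I-\mathbf M^{-1}\mathbf A^\top\mathbf\Gamma^{-1}\mathbf A&-\mathbf M^{-1}\mathbf A^\top\\0&\mathbf I\end{bmatrix}$; i.e. $\mathbf p^{k+1}=\mathrm{prox}_{g^*}^{\mathbf\Gamma}(\mathbf p^k+\mathbf\Gamma^{-1}\mathbf A\mathbf x^k)$, $\tilde{\mathbf x}^k=\mathrm{prox}_f^{\mathbf M}(\mathbf x^k-\mathbf M^{-1}\mathbf A^\top\mathbf p^{k+1})$, $\mathbf x^{k+1}=\tilde{\mathbf x}^k-\mathbf M^{-1}\mathbf A^\top\mathbf\Gamma^{-1}\mathbf A(\tilde{\mathbf x}^k-\mathbf x^k)-\mathbf M^{-1}\mathbf A^\top(\mathbf p^{k+1}-\mathbf p^k)$. PDS-IV: $\mathcal Q=\begin{bmatrix}\mathbf M&-\mathbf A^\top\\0&\mathbf\Gamma\end{bmatrix}$, $\mathcal M=\begin{bmatrix}\mathbf I&0\\\mathbf\Gamma^{-1}\mathbf A&\mathbf I-\mathbf\Gamma^{-1}\mathbf A\mathbf M^{-1}\mathbf A^\top\end{bmatrix}$; i.e. $\mathbf x^{k+1}=\mathrm{prox}_f^{\mathbf M}(\mathbf x^k-\mathbf M^{-1}\mathbf A^\top\mathbf p^k)$, $\tilde{\mathbf p}^k=\mathrm{prox}_{g^*}^{\mathbf\Gamma}(\mathbf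 p^k+\mathbf\Gamma^{-1}\mathbf A\mathbf x^{k+1})$, $\mathbf p^{k+1}=\tilde{\mathbf p}^k-\mathbf\Gamma^{-1}\mathbf A\mathbf M^{-1}\mathbf A^\top(\tilde{\mathbf p}^k-\mathbf p^k)+\mathbf\Gamma^{-1}\mathbf A(\mathbf x^{k+1}-\mathbf x^k)$. PDS-V: $\mathcal Q=\begin{bmatrix}\mathbf M&0\\\mathbf A&\mathbf\Gamma\end{bmatrix}$, $\mathcal M=\begin{bmatrix}\mathbf I&0\\\mathbf\Gamma^{-1}\mathbf A&\mathbf I\end{bmatrix}$; i.e. $\tilde{\mathbf p}^k=\mathrm{prox}_{g^*}^{\mathbf\Gamma}(\mathbf p^k+\mathbf\Gamma^{-1}\mathbf A\mathbf x^k)$, $\mathbf x^{k+1}=\mathrm{prox}_f^{\mathbf M}(\mathbf x^k-\mathbf M^{-1}\mathbf A^\top\tilde{\mathbf p}^k)$, $\mathbf p^{k+1}=\tilde{\mathbf p}^k+\mathbf\Gamma^{-1}\mathbf A(\mathbf x^{k+1}-\mathbf x^k)$. PDS-VI: $\mathcal Q=\begin{bmatrix}\mathbf M&-\mathbf A^\top\\0&\mathbf\Gamma\end{bmatrix}$, $\mathcal M=\begin{bmatrix}\mathbf I&-\mathbf M^{-1}\mathbf A^\top\\0&\mathbf I\end{bmatrix}$; i.e. $\tilde{\mathbf x}^k=\mathrm{prox}_f^{\mathbf M}(\mathbf x^k-\mathbf M^{-1}\mathbf A^\top\mathbf p^k)$, $\mathbf p^{k+1}=\mathrm{prox}_{g^*}^{\mathbf\Gamma}(\mathbf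 p^k+\mathbf\Gamma^{-1}\mathbf A\tilde{\mathbf x}^k)$, $\mathbf x^{k+1}=\tilde{\mathbf x}^k-\mathbf M^{-1}\mathbf A^\top(\mathbf p^{k+1}-\mathbf p^k)$. PDS-VII: $\mathcal Q=\begin{bmatrix}\mathbf M&-\mathbf A^\top\\\mathbf A&\mathbf\Gamma\end{bmatrix}$, $\mathcal M=\begin{bmatrix}\mathbf I&-\mathbf M^{-1}\mathbf A^\top\\\mathbf\Gamma^{-1}\mathbf A&\mathbf I\end{bmatrix}$; i.e. $\tilde{\mathbf x}^k=\mathrm{prox}_f^{\mathbf M}(\mathbf x^k-\mathbf M^{-1}\mathbf A^\top\mathbf p^k)$, $\tilde{\mathbf p}^k=\mathrm{prox}_{g^*}^{\mathbf\Gamma}(\mathbf p^k+\mathbf\Gamma^{-1}\mathbf A\mathbf x^k)$, $\mathbf x^{k+1}=\tilde{\mathbf x}^k-\mathbf M^{-1}\mathbf A^\top(\tilde{\mathbf p}^k-\mathbf p^k)$, $\mathbf p^{k+1}=\tilde{\mathbf p}^k+\mathbf\Gamma^{-1}\mathbf A(\tilde{\mathbf x}^k-\mathbf x^k)$. *)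

(* Defs.v *)
From mathcomp Require Import all_boot all_order all_algebra.
From mathcomp Require Import all_classical all_reals all_analysis.

Set Implicit Arguments.
Unset Strict Implicit.
Unset Printing Implicit Defensive.

Import Order.TTheory GRing.Theory Num.Theory.
Import numFieldNormedType.Exports.

Local Open Scope classical_set_scope.
Local Open Scope ring_scope.

Definition dot (R : realType) (n : nat) (u v : 'cV[R]_n) : R :=
  (u^T *m v) 0 0.

(* |u|_B^2 = <u, B u> *)
Definition sqnorm (R : realType) (n : nat) (B : 'M[R]_n) (u : 'cV[R]_n) : R :=
  dot u (B *m u).

Definition posdefmx (R : realType) (n : nat) (B : 'M[R]_n) : Prop :=
  B \is symmetricmx /\ forall u : 'cV[R]_n, u != 0 -> 0 < sqnorm B u.

(* A function R^n -> R U {+oo} is encoded as a \bar R-valued function which is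
   nowhere -oo; the latter is part of properness. *)
Definition proper_fun (R : realType) (n : nat) (f : 'cV[R]_n -> \bar R) : Prop :=
  (forall x, f x != -oo%E) /\ (exists x, f x != +oo%E).

Definition convex_efun (R : realType) (n : nat) (f : 'cV[R]_n -> \bar R) : Prop :=
  forall (x y : 'cV[R]_n) (t : R), 0 < t -> t < 1 ->
    (f ((t *: x + (1 - t) *: y)%R) <= t%:E * f x + (1 - t)%:E * f y)%E.

Definition fenchel (R : realType) (n : nat) (g : 'cV[R]_n -> \bar R)
    (p : 'cV[R]_n) : \bar R :=
  ereal_sup [set ((dot p y)%:E - g y)%E | y in [set: 'cV[R]_n]].

(* For proper f, the subdifferential is empty outside the domain of f. *)
Definition subdiff (R : realType) (n : nat) (f : 'cV[R]_n -> \bar R)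
    (x : 'cV[R]_n) : set 'cV[R]_n :=
  [set u | forall y, (f x + (dot u (y - x)%R)%:E <= f y)%E].

(* The set of minimizers; it has at most one element for f proper convex and
   B positive definite. *)
Definition prox (R : realType) (n : nat) (f : 'cV[R]_n -> \bar R)
    (B : 'M[R]_n) (u : 'cV[R]_n) : set 'cV[R]_n :=
  [set w | forall w', (f w + (2^-1 * sqnorm B (w - u))%R%:E
                       <= f w' + (2^-1 * sqnorm B (w' - u))%R%:E)%E].

(* In \bar R, +oo - +oo = -oo; this convention is only relevant when x is
   outside the domain of f and p outside the domain of the conjugate of g. *)
Definition lagrangian (R : realType) (n m : nat) (f : 'cV[R]_n -> \bar R)
    (g : 'cV[R]_m -> \bar R) (A : 'M[R]_(m, n))
    (x : 'cV[R]_n) (p : 'cV[R]_m) : \bar R :=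
  (f x + (dot p (A *m x))%:E - fenchel g p)%E.

(* The primal-dual variable c = (x, p) is the column vector col_mx x p, so that
   x = usubmx c and p = dsubmx c. *)
Definition prodset (R : realType) (n m : nat) (B1 : set 'cV[R]_n)
    (B2 : set 'cV[R]_m) : set 'cV[R]_(n + m) :=
  [set c | B1 (usubmx c) /\ B2 (dsubmx c)].

Definition pd_gap (R : realType) (n m : nat) (f : 'cV[R]_n -> \bar R)
    (g : 'cV[R]_m -> \bar R) (A : 'M[R]_(m, n))
    (B1 : set 'cV[R]_n) (B2 : set 'cV[R]_m) (c : 'cV[R]_(n + m)) : \bar R :=
  (ereal_sup [set lagrangian f g A (usubmx c) p' | p' in B2]
   - ereal_inf [set lagrangian f g A x' (dsubmx c) | x' in B1])%E.

(* [ \partial f , A^T ; - A , \partial g^* ] as a set-valued map *)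
Definition pd_operator (R : realType) (n m : nat) (f : 'cV[R]_n -> \bar R)
    (g : 'cV[R]_m -> \bar R) (A : 'M[R]_(m, n)) (c : 'cV[R]_(n + m)) :
    set 'cV[R]_(n + m) :=
  [set col_mx (u + A^T *m dsubmx c) (- A *m usubmx c + v)
     | u in subdiff f (usubmx c) & v in subdiff (fenchel g) (dsubmx c)].

Definition zer (R : realType) (n : nat) (T : 'cV[R]_n -> set 'cV[R]_n) :
    set 'cV[R]_n :=
  [set c | T c 0].

Inductive pds : Set :=
  PDS_I | PDS_II | PDS_III | PDS_IV | PDS_V | PDS_VI | PDS_VII.

Definition pds_Q (s : pds) (R : realType) (n m : nat) (A : 'M[R]_(m, n))
    (M : 'M[R]_n) (G : 'M[R]_m) : 'M[R]_(n + m) :=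
  match s with
  | PDS_I => block_mx M (- A^T) (- A) G
  | PDS_II => block_mx M A^T A G
  | PDS_III => block_mx M 0 A G
  | PDS_IV => block_mx M (- A^T) 0 G
  | PDS_V => block_mx M 0 A G
  | PDS_VI => block_mx M (- A^T) 0 G
  | PDS_VII => block_mx M (- A^T) A G
  end.

Definition pds_M (s : pds) (R : realType) (n m : nat) (A : 'M[R]_(m, n))
    (M : 'M[R]_n) (G : 'M[R]_m) : 'M[R]_(n + m) :=
  let MA := invmx M *m A^T in
  let GA := invmx G *m A in
  match s with
  | PDS_I => 1%:M
  | PDS_II => 1%:M
  | PDS_III => block_mx (1%:M - MA *m GA) (- MA) 0 1%:M
  | PDS_IV => block_mx 1%:M 0 GA (1%:M - GA *m MA)
  | PDS_V => block_mx 1%:M 0 GA 1%:M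
  | PDS_VI => block_mx 1%:M (- MA) 0 1%:M
  | PDS_VII => block_mx 1%:M (- MA) GA 1%:M
  end.

Definition pds_S (s : pds) (R : realType) (n m : nat) (A : 'M[R]_(m, n))
    (M : 'M[R]_n) (G : 'M[R]_m) : 'M[R]_(n + m) :=
  pds_Q s A M G *m invmx (pds_M s A M G).

(* One iteration from c = (x, p) to c1 = (x1, p1), with proximal output
   ct = (xt, pt). By the optimality conditions of the two proximal steps, this
   is the generalized proximal point step
     0 \in pd_operator f g A ct + Q *m (ct - c),  c1 = c + M *m (ct - c)
   for Q := pds_Q s and M := pds_M s. *)
Definition pds_step (s : pds) (R : realType) (n m : nat)
    (f : 'cV[R]_n -> \bar R) (g : 'cV[R]_m -> \bar R) (A : 'M[R]_(m, n))
    (M : 'M[R]_n) (G : 'M[R]_m)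
    (x : 'cV[R]_n) (p : 'cV[R]_m) (xt : 'cV[R]_n) (pt : 'cV[R]_m)
    (x1 : 'cV[R]_n) (p1 : 'cV[R]_m) : Prop :=
  let MA := invmx M *m A^T in
  let GA := invmx G *m A in
  let gs := fenchel g in
  match s with
  | PDS_I =>
      [/\ prox f M (x - MA *m p) x1,
          prox gs G (p + GA *m (2 *: x1 - x)) p1,
          xt = x1 & pt = p1]
  | PDS_II =>
      [/\ prox gs G (p + GA *m x) p1,
          prox f M (x - MA *m (2 *: p1 - p)) x1,
          xt = x1 & pt = p1]
  | PDS_III =>
      [/\ prox gs G (p + GA *m x) p1,
          prox f M (x - MA *m p1) xt,
          x1 = xt - MA *m GA *m (xt - x) - MA *m (p1 - p)
        & pt = p1]
  | PDS_IV =>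
      [/\ prox f M (x - MA *m p) x1,
          prox gs G (p + GA *m x1) pt,
          p1 = pt - GA *m MA *m (pt - p) + GA *m (x1 - x)
        & xt = x1]
  | PDS_V =>
      [/\ prox gs G (p + GA *m x) pt,
          prox f M (x - MA *m pt) x1,
          p1 = pt + GA *m (x1 - x)
        & xt = x1]
  | PDS_VI =>
      [/\ prox f M (x - MA *m p) xt,
          prox gs G (p + GA *m xt) p1,
          x1 = xt - MA *m (p1 - p)
        & pt = p1]
  | PDS_VII =>
      [/\ prox f M (x - MA *m p) xt,
          prox gs G (p + GA *m x) pt,
          x1 = xt - MA *m (pt - p)
        & p1 = pt + GA *m (xt - x)]
  end.

Definition pds_generated (s : pds) (R : realType) (n m : nat)
    (f : 'cV[R]_n -> \bar R) (g : 'cV[R]_m -> \bar R) (A : 'M[R]_(m, n))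
    (M : 'M[R]_n) (G : 'M[R]_m) (c ct : nat -> 'cV[R]_(n + m)) : Prop :=
  forall k, pds_step s f g A M G
    (usubmx (c k)) (dsubmx (c k)) (usubmx (ct k)) (dsubmx (ct k))
    (usubmx (c k.+1)) (dsubmx (c k.+1)).

Definition average (R : realType) (n : nat) (c : nat -> 'cV[R]_n) (k : nat) :
    'cV[R]_n :=
  k%:R^-1 *: \sum_(0 <= i < k) c i.

(* Main.v *)
Require Import Defs.
From mathcomp Require Import all_boot all_order all_algebra.
From mathcomp Require Import all_classical all_reals all_analysis.
From mathcomp Require Import finmap ring lra.

Import Order.TTheory GRing.Theory Num.Theory.
Import numFieldNormedType.Exports.

Local Open Scope classical_set_scope.
Local Open Scope ring_scope.

(* Write P for the matrix called M in the generalized proximal point scheme and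
   d_i = ct_i - c_i, so that c_{i+1} = c_i + P d_i. The subgradient inequalities
   at ct_i bound L(xt_i, p') - L(x', pt_i) by <Q d_i, c' - ct_i>. For each scheme
   H = P^T Q is symmetric positive definite and H <= Q + Q^T; hence P is
   invertible, S = Q P^-1 is symmetric and positive semidefinite, and
   2 <Q d_i, c' - ct_i> <= |c_i - c'|_S^2 - |c_{i+1} - c'|_S^2. This telescopes,
   and convexity of f and of the conjugate of g gives the bound for the average.
   Lower semicontinuity of g enters only through the properness of its
   conjugate, which makes the values at the proximal outputs finite. *)

Set Implicit Arguments.
Unset Strict Implicit.
Unset Printing Implicit Defensive.

(** * Inner product and positive definite matrices *)

Lemma dotE (R : realType) n (u v : 'cV[R]_n) :
  dot u v = \sum_i u i 0 * v i 0.
Proof. by rewrite /dot !mxE; apply: eq_bigr => i _; rewrite !mxE. Qed.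

Lemma dotC (R : realType) n (u v : 'cV[R]_n) : dot u v = dot v u.
Proof. by rewrite !dotE; apply: eq_bigr => i _; rewrite mulrC. Qed.

Lemma dotDr (R : realType) n (u v w : 'cV[R]_n) :
  dot u (v + w) = dot u v + dot u w.
Proof. by rewrite /dot mulmxDr !mxE. Qed.

Lemma dotNr (R : realType) n (u v : 'cV[R]_n) : dot u (- v) = - dot u v.
Proof. by rewrite /dot mulmxN !mxE. Qed.

Lemma dotZr (R : realType) n a (u v : 'cV[R]_n) : dot u (a *: v) = a * dot u v.
Proof. by rewrite /dot -scalemxAr !mxE. Qed.

Lemma dotDl (R : realType) n (u v w : 'cV[R]_n) :
  dot (u + v) w = dot u w + dot v w.
Proof. by rewrite dotC dotDr !(dotC w). Qed.

Lemma dotNl (R : realType) n (u v : 'cV[R]_n) : dot (- u) v = - dot u v.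
Proof. by rewrite dotC dotNr dotC. Qed.

Lemma dotZl (R : realType) n a (u v : 'cV[R]_n) : dot (a *: u) v = a * dot u v.
Proof. by rewrite dotC dotZr dotC. Qed.

Lemma dot0r (R : realType) n (u : 'cV[R]_n) : dot u 0 = 0.
Proof. by rewrite /dot mulmx0 mxE. Qed.

Lemma dot0l (R : realType) n (u : 'cV[R]_n) : dot 0 u = 0.
Proof. by rewrite dotC dot0r. Qed.

Definition dot_lin := (dotDr, dotDl, dotNr, dotNl, dotZr, dotZl).

Lemma dot_tr (R : realType) n m (B : 'M[R]_(m, n)) (x : 'cV[R]_n) (p : 'cV[R]_m) :
  dot x (B^T *m p) = dot p (B *m x).
Proof. by rewrite [RHS]dotC /dot trmx_mul mulmxA. Qed.

Lemma dot_col_mx (R : realType) n m (x y : 'cV[R]_n) (p q : 'cV[R]_m) :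
  dot (col_mx x p) (col_mx y q) = dot x y + dot p q.
Proof. by rewrite /dot tr_col_mx mul_row_col mxE. Qed.

Lemma posdefmx_sym (R : realType) n (B : 'M[R]_n) : posdefmx B -> B^T = B.
Proof. by move=> [/is_hermitianmxP + _]; rewrite expr0 scale1r map_mx_id. Qed.

Lemma dot_sym (R : realType) n (B : 'M[R]_n) (x y : 'cV[R]_n) :
  B^T = B -> dot x (B *m y) = dot y (B *m x).
Proof. by move=> Bs; rewrite -[in RHS](dot_tr B) Bs. Qed.

Lemma posdefmx_ge0 (R : realType) n (B : 'M[R]_n) x :
  posdefmx B -> 0 <= dot x (B *m x).
Proof.
move=> [_ Bpos]; have [->|/Bpos/ltW//] := eqVneq x 0.
by rewrite dot0l.
Qed.

(** Each row of the left kernel of [B^T] is the transpose of a vector killed by [B]. *)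
Lemma unitmx_inj (R : realType) n (B : 'M[R]_n) :
  (forall x : 'cV[R]_n, B *m x = 0 -> x = 0) -> B \in unitmx.
Proof.
move=> Binj; rewrite -unitmx_tr -row_free_unit -kermx_eq0.
apply/eqP/row_matrixP => i.
rewrite row0; apply: trmx_inj; rewrite trmx0; apply: Binj.
by rewrite -{1}[B]trmxK -trmx_mul -row_mul mulmx_ker row0 trmx0.
Qed.

Lemma posdefmx_unit (R : realType) n (B : 'M[R]_n) : posdefmx B -> B \in unitmx.
Proof.
move=> [_ Bpos]; apply: unitmx_inj => x Bx0; apply/eqP/negPn/negP => /Bpos.
by rewrite /sqnorm Bx0 dot0r ltxx.
Qed.

(** * Quadratic forms attached to the seven schemes *)

Section scheme_matrices.
Variables (R : realType) (n m : nat) (A : 'M[R]_(m, n)).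
Variables (M : 'M[R]_n) (G : 'M[R]_m).
Hypotheses (M_posdef : posdefmx M) (G_posdef : posdefmx G).
Hypothesis MG_posdef : posdefmx (M - A^T *m invmx G *m A).

Implicit Types (x y : 'cV[R]_n) (p q : 'cV[R]_m).

Let a := invmx M *m A^T.
Let b := invmx G *m A.

Lemma mulM_a p : M *m (a *m p) = A^T *m p.
Proof. by rewrite /a !mulmxA mulmxV ?mul1mx// posdefmx_unit. Qed.

Lemma mulG_b x : G *m (b *m x) = A *m x.
Proof. by rewrite /b !mulmxA mulmxV ?mul1mx// posdefmx_unit. Qed.

Lemma dotaM p y : dot (a *m p) (M *m y) = dot p (A *m y).
Proof. by rewrite (dot_sym _ _ (posdefmx_sym M_posdef)) mulM_a dot_tr. Qed.

Lemma dotbG x q : dot (b *m x) (G *m q) = dot q (A *m x).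
Proof. by rewrite (dot_sym _ _ (posdefmx_sym G_posdef)) mulG_b. Qed.

Lemma dota_sym p q : dot p (A *m (a *m q)) = dot q (A *m (a *m p)).
Proof. by rewrite -dotaM (dot_sym _ _ (posdefmx_sym M_posdef)) dotaM. Qed.

Lemma dotb_sym x y : dot (b *m x) (A *m y) = dot (b *m y) (A *m x).
Proof. by rewrite -dotbG (dot_sym _ _ (posdefmx_sym G_posdef)) dotbG. Qed.

Lemma schur_x x : x != 0 -> dot (b *m x) (A *m x) < dot x (M *m x).
Proof.
move=> x0; have := MG_posdef.2 x x0.
rewrite /sqnorm mulmxBl -!mulmxA !dot_lin dot_tr mulmxA -/b subr_gt0.
by rewrite dotC.
Qed.

Lemma sq_xap x p :
  dot (x + a *m p) (M *m (x + a *m p)) =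
  dot x (M *m x) + 2 * dot p (A *m x) + dot p (A *m (a *m p)).
Proof. by rewrite mulmxDr !dot_lin !dotaM mulM_a dot_tr; ring. Qed.

Lemma sq_pbx x p :
  dot (p + b *m x) (G *m (p + b *m x)) =
  dot p (G *m p) + 2 * dot p (A *m x) + dot (b *m x) (A *m x).
Proof. by rewrite mulmxDr !dot_lin !dotbG mulG_b dotC; ring. Qed.

(** This is the equivalent condition on the other Schur complement. With [x = a *m p], expanding
    [|p - b x|_G^2 >= 0] gives [2 <p, A x> <= <p, G p> + <b x, A x>], and for [x != 0] the last term
    is below [<x, M x> = <p, A x>]. *)
Lemma schur_p p : p != 0 -> dot p (A *m (a *m p)) < dot p (G *m p).
Proof.
move=> p0; have Gp := G_posdef.2 p p0; rewrite /sqnorm in Gp.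
have [->|/schur_x] := eqVneq (a *m p) 0; first by rewrite mulmx0 dot0r.
have := posdefmx_ge0 (p - b *m (a *m p)) G_posdef.
rewrite -mulmxN sq_pbx !mulmxN !dot_lin dotaM; lra.
Qed.

Lemma forms_ge0 x p :
  [/\ 0 <= dot x (M *m x), 0 <= dot p (G *m p),
      0 <= dot (b *m x) (A *m x) <= dot x (M *m x) &
      0 <= dot p (A *m (a *m p)) <= dot p (G *m p)].
Proof.
split; [exact: posdefmx_ge0|exact: posdefmx_ge0| |]; apply/andP; split.
- by rewrite -mulG_b posdefmx_ge0.
- by have [->|/schur_x/ltW//] := eqVneq x 0; rewrite !mulmx0 !dot0l.
- by rewrite -dotaM posdefmx_ge0.
- by have [->|/schur_p/ltW//] := eqVneq p 0; rewrite !dot0l.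
Qed.

(** Nonnegativity of the completed squares [|x + a p|_M^2] and [|p + b x|_G^2], with both signs of
    the cross term. *)
Lemma cross_le x p :
  [/\ `|2 * dot p (A *m x)| <= dot x (M *m x) + dot p (A *m (a *m p)) &
      `|2 * dot p (A *m x)| <= dot p (G *m p) + dot (b *m x) (A *m x)].
Proof.
have := posdefmx_ge0 (x + a *m p) M_posdef.
have := posdefmx_ge0 (x + a *m - p) M_posdef.
have := posdefmx_ge0 (p + b *m x) G_posdef.
have := posdefmx_ge0 (p + b *m - x) G_posdef.
rewrite !sq_xap !sq_pbx !mulmxN !dot_lin.
by move=> *; split; rewrite ler_norml; apply/andP; split; lra.
Qed.

(* [pds_M^T *m pds_Q = pds_M^T *m pds_S *m pds_M] is congruent to [pds_S], and
   unlike [pds_S] it can be written down without inverting [pds_M]. *)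
Lemma pds_M_Q_sym s (d e : 'cV[R]_(n + m)) :
  dot (pds_M s A M G *m d) (pds_Q s A M G *m e) =
  dot (pds_M s A M G *m e) (pds_Q s A M G *m d).
Proof.
rewrite -[d]vsubmxK -[e]vsubmxK.
move: (usubmx d) (dsubmx d) (usubmx e) (dsubmx e) => x p y q.
have Msym := dot_sym x y (posdefmx_sym M_posdef).
have Gsym := dot_sym p q (posdefmx_sym G_posdef).
case: s; rewrite /pds_M /pds_Q -/a -/b ?mul1mx ?mul_block_col !dot_col_mx
  ?mul1mx ?mul0mx ?addr0 ?add0r ?mulmxBl ?mulNmx ?mul1mx
  -?(mulmxA a b) -?(mulmxA b a) !dot_lin ?dot_tr ?dotaM ?dotbG Msym Gsym
  ?(dota_sym p q) ?(dotb_sym x y)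
  ?(dotC (A *m x)) ?(dotC (A *m y)); ring.
Qed.

(** Put [V = <b x, A x>], [W = <p, A a p>], [C = 2 <p, A x>]. Up to the common
    [<x, M x> + <p, G p>], the form is [- C] (I), [C] (II), [- V] (III), [- W] (IV), [V + C] (V),
    [W - C] (VI), [V + W] (VII). Any cross term is absorbed by [cross_le], and strictness comes from
    the Schur inequality of the nonzero component. *)
Lemma pds_M_Q_pos s (d : 'cV[R]_(n + m)) : d != 0 ->
  0 < dot (pds_M s A M G *m d) (pds_Q s A M G *m d).
Proof.
rewrite -[d]vsubmxK; move: (usubmx d) (dsubmx d) => x p.
rewrite col_mx_eq0 negb_and => xp0.
have [Mx Gp /andP[V0 V1] /andP[W0 W1]] := forms_ge0 x p.
have [] := cross_le x p; rewrite !ler_norml => /andP[? ?] /andP[? ?].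
have Px : x != 0 -> dot (b *m x) (A *m x) < dot x (M *m x) by exact: schur_x.
have Pp : p != 0 -> dot p (A *m (a *m p)) < dot p (G *m p) by exact: schur_p.
have x0 : x = 0 -> dot p (A *m x) = 0 by move=> ->; rewrite mulmx0 dot0r.
have p0 : p = 0 -> dot p (A *m x) = 0 by move=> ->; rewrite dot0l.
case: s; rewrite /pds_M /pds_Q -/a -/b ?mul1mx ?mul_block_col !dot_col_mx
  ?mul1mx ?mul0mx ?addr0 ?add0r ?mulmxBl ?mulNmx ?mul1mx
  -?(mulmxA a b) -?(mulmxA b a) !dot_lin ?dot_tr ?dotaM ?dotbG ?(dotC (A *m x));
  case/orP: xp0 => [/[dup] /Px ? ?|/[dup] /Pp ? ?]; try lra.
all: try (have [/x0 ?|/Px ?] := eqVneq x 0; lra).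
all: try (have [/p0 ?|/Pp ?] := eqVneq p 0; lra).
Qed.

Lemma pds_M_Q_le s (d : 'cV[R]_(n + m)) :
  dot (pds_M s A M G *m d) (pds_Q s A M G *m d) <=
  2 * dot d (pds_Q s A M G *m d).
Proof.
rewrite -[d]vsubmxK; move: (usubmx d) (dsubmx d) => x p.
have [Mx Gp /andP[V0 V1] /andP[W0 W1]] := forms_ge0 x p.
have [] := cross_le x p; rewrite !ler_norml => /andP[? ?] /andP[? ?].
case: s; rewrite /pds_M /pds_Q -/a -/b ?mul1mx ?mul_block_col !dot_col_mx
  ?mul1mx ?mul0mx ?addr0 ?add0r ?mulmxBl ?mulNmx ?mul1mx
  -?(mulmxA a b) -?(mulmxA b a) !dot_lin ?dot_tr ?dotaM ?dotbG
  ?(dotC (A *m x)); lra.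
Qed.

Lemma pds_M_unit s : pds_M s A M G \in unitmx.
Proof.
apply: unitmx_inj => d Md0; apply/eqP/negPn/negP => /(pds_M_Q_pos s).
by rewrite Md0 dot0l ltxx.
Qed.

(** Writing [e = P d] with [P] the matrix [pds_M], the form becomes [<P d, Q d>]. *)
Lemma pds_S_ge0 s (e : 'cV[R]_(n + m)) : 0 <= sqnorm (pds_S s A M G) e.
Proof.
rewrite -[e](mulKVmx (pds_M_unit s)) /sqnorm /pds_S.
rewrite [X in dot _ X]mulmxA mulmxKV ?pds_M_unit //.
move: (invmx _ *m e) => d; have [->|/(pds_M_Q_pos s)/ltW//] := eqVneq d 0.
by rewrite !mulmx0 dot0l.
Qed.

(** Since [S P = Q] and [S] is symmetric, the right side equals [2 <c' - c, Q d> - <P d, Q d>], and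
    [<P d, Q d> <= 2 <d, Q d>]. *)
Lemma pds_three_point s (c c' d : 'cV[R]_(n + m)) :
  2 * dot (c' - (c + d)) (pds_Q s A M G *m d) <=
  sqnorm (pds_S s A M G) (c - c')
  - sqnorm (pds_S s A M G) (c + pds_M s A M G *m d - c').
Proof.
set Q := pds_Q _ _ _ _; set P := pds_M _ _ _ _; set S := pds_S _ _ _ _.
have Pu : P \in unitmx := pds_M_unit s.
have SP e : S *m (P *m e) = Q *m e by rewrite /S /pds_S -/P -/Q mulmxA mulmxKV.
have Ssym e e' : dot e (S *m e') = dot e' (S *m e).
  rewrite -[e](mulKVmx Pu) -[e'](mulKVmx Pu) !SP; exact: pds_M_Q_sym.
have -> : c + P *m d - c' = (c - c') + P *m d by rewrite addrAC.
have := pds_M_Q_le s d; rewrite -/P -/Q.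
rewrite /sqnorm !mulmxDr !dot_lin (Ssym (P *m d) c) (Ssym (P *m d) (- c')).
rewrite SP !dot_lin; lra.
Qed.

End scheme_matrices.

(** * Proximal points and subgradients *)

Lemma ge0_of_small (R : realType) (c K t0 : R) : 0 < t0 ->
  (forall t, 0 < t -> t < t0 -> 0 <= c + t * K) -> 0 <= c.
Proof.
move=> t0_gt0 H; rewrite leNgt; apply/negP => c_lt0.
have K_gt0 : 0 < `|K| + 1 by rewrite ltr_wpDl.
(* This [t] keeps [t * K] at most [- c / 2], so that [c + t * K] is still negative. *)
pose t := Num.min (t0 / 2) (- c / 2 / (`|K| + 1)).
have t_gt0 : 0 < t by rewrite lt_min !divr_gt0 ?oppr_gt0.
have t_lt : t < t0 by rewrite gt_min; apply/orP; left; lra.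
have : t * (`|K| + 1) <= - c / 2.
  by rewrite -ler_pdivlMr // ge_min lexx orbT.
have := H t t_gt0 t_lt.
have : t * K <= t * `|K| by rewrite ler_pM2l // ler_norm.
rewrite mulrDr mulr1; lra.
Qed.

(** Bound [f] on the segment from [w] to [y] by convexity, divide by [t] and let [t] tend to 0.
    Minimality is asked only on a short initial piece of each segment, which covers both proximal
    points and minimizers interior to a ball. *)
Lemma local_min_subdiff (R : realType) n (f : 'cV[R]_n -> \bar R) (B : 'M[R]_n)
    (u w : 'cV[R]_n) :
  (forall x, f x != -oo%E) -> convex_efun f -> B^T = B -> f w != +oo%E ->
  (forall y, exists2 t0 : R, 0 < t0 & forall t, 0 < t -> t < t0 ->
    (f w + (2^-1 * sqnorm B (w - u))%:E <=
     f (w + t *: (y - w))%R + (2^-1 * sqnorm B (w + t *: (y - w) - u))%:E)%E) ->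
  subdiff f w (B *m (u - w)).
Proof.
move=> fNy fconv Bs fwy wmin y.
have := fNy w; move: fwy; case fw : (f w) => [a| |] // _ _.
have := fNy y; case fy : (f y) => [r| |] // _; last by rewrite leey.
rewrite -EFinD lee_fin.
have [t0 t0_gt0 wmint] := wmin y.
have t1_gt0 : 0 < Num.min t0 1 by rewrite lt_min t0_gt0 ltr01.
suff : 0 <= r - a - dot (B *m (u - w)) (y - w) by lra.
apply: (ge0_of_small (K := 2^-1 * sqnorm B (y - w)) t1_gt0) => t t_gt0.
rewrite lt_min => /andP[tt0 t1].
have := wmint t t_gt0 tt0.
have := fconv y w t t_gt0 t1; rewrite fw fy.
have -> : t *: y + (1 - t) *: w = w + t *: (y - w).
  by rewrite scalerBl scale1r scalerBr addrCA.
rewrite -!EFinM -EFinD.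
case: (f _) (fNy (w + t *: (y - w))) => [s| |] // _.
rewrite -!EFinD !lee_fin /sqnorm => H1 H2.
have E : w + t *: (y - w) - u = (w - u) + t *: (y - w) by rewrite addrAC.
have -> : dot (B *m (u - w)) (y - w) = - dot (y - w) (B *m (w - u)).
  by rewrite -(opprB w u) mulmxN dotNl dotC.
move: H2; rewrite E; move: (w - u) (y - w) => v z.
rewrite mulmxDr -scalemxAr !dot_lin (dot_sym v z Bs) => H2.
suff : 0 <= t * (r - a - - dot z (B *m v) + t * (2^-1 * dot z (B *m z))).
  by rewrite pmulr_rge0.
move: H1 H2; set zv := dot z (B *m v); set zz := dot z (B *m z); lra.
Qed.

Lemma prox_subdiff (R : realType) n (f : 'cV[R]_n -> \bar R) (B : 'M[R]_n)
    (u w : 'cV[R]_n) :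
  proper_fun f -> convex_efun f -> B^T = B -> prox f B u w ->
  f w \is a fin_num /\ subdiff f w (B *m (u - w)).
Proof.
move=> [fNy [x0 fx0]] fconv Bs wmin.
have fwy : f w != +oo%E.
  apply/negP => /eqP fwy; have := wmin x0; rewrite fwy addye //.
  by case: (f x0) fx0 (fNy x0).
split; first by rewrite fin_numE fNy fwy.
apply: local_min_subdiff => // y; exists 1 => // t _ _; exact: wmin.
Qed.

(** * Jensen's inequality for averages *)

Lemma convex_average (R : realType) n (f : 'cV[R]_n -> \bar R)
    (x : nat -> 'cV[R]_n) (r : nat -> R) k : (0 < k)%N ->
  convex_efun f -> (forall i, (i < k)%N -> (f (x i) <= (r i)%:E)%E) ->
  (f (average x k) <= (k%:R^-1 * \sum_(0 <= i < k) r i)%:E)%E.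
Proof.
move=> + fconv; case: k => // k _; elim: k => [|k IH] fx.
  by rewrite /average !big_nat1 invr1 scale1r mul1r fx.
(* The average of [k.+2] points is the average of the first [k.+1] with weight [t], plus the last
   point with weight [1 - t = 1 / k.+2]. *)
pose t : R := k.+1%:R / k.+2%:R.
have k1 : (0 : R) < k.+1%:R by rewrite ltr0n.
have k2 : (0 : R) < k.+2%:R by rewrite ltr0n.
have t_gt0 : 0 < t by rewrite divr_gt0.
have t1 : 1 - t = k.+2%:R^-1.
  apply: (mulIf (lt0r_neq0 k2)); rewrite mulrBl mulVf ?lt0r_neq0 // /t.
  by rewrite divfK ?lt0r_neq0 // mul1r -[k.+2]addn1 natrD addrAC subrr add0r.
have t_lt1 : t < 1 by rewrite -subr_gt0 t1 invr_gt0.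
have tk : t * k.+1%:R^-1 = k.+2%:R^-1 by rewrite mulrAC divff ?mul1r ?lt0r_neq0.
have -> : average x k.+2 = t *: average x k.+1 + (1 - t) *: x k.+1.
  by rewrite /average big_nat_recr //= scalerDr scalerA tk t1.
apply: (le_trans (fconv _ _ _ t_gt0 t_lt1)).
have -> : k.+2%:R^-1 * \sum_(0 <= i < k.+2) r i =
    t * (k.+1%:R^-1 * \sum_(0 <= i < k.+1) r i) + (1 - t) * r k.+1.
  by rewrite mulrA tk t1 [in LHS]big_nat_recr //= mulrDr.
rewrite [in leRHS]EFinD [X in (_ <= X + _)%E]EFinM [X in (_ <= _ + X)%E]EFinM.
apply: leeD; apply: lee_wpmul2l;
  rewrite ?lee_fin ?subr_ge0 ?(ltW t_gt0) ?(ltW t_lt1) //.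
- by apply: IH => i ik; apply: fx; apply: ltnW.
- exact: fx.
Qed.

(** * Convexity and properness of the Fenchel conjugate *)

Lemma fenchel_Ny (R : realType) n (g : 'cV[R]_n -> \bar R) p :
  proper_fun g -> fenchel g p != -oo%E.
Proof.
move=> [gNy [y gy]].
have : ((dot p y)%:E - g y <= fenchel g p)%E.
  by apply: ereal_sup_ubound; exists y.
move: gy (gNy y); case: (g y) => // r _ _.
by case: (fenchel g p).
Qed.

(** A supremum of functions affine in [p]; a [y] with [g y = +oo] contributes only [-oo]. *)
Lemma fenchel_convex (R : realType) n (g : 'cV[R]_n -> \bar R) :
  proper_fun g -> convex_efun (fenchel g).
Proof.
move=> [gNy _] p q t t_gt0 t_lt1; apply: ge_ereal_sup => _ [y _ <-].
have ub p' : ((dot p' y)%:E - g y <= fenchel g p')%E.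
  by apply: ereal_sup_ubound; exists y.
move: (gNy y) (ub p) (ub q); case: (g y) => [r| |] // _ Hp Hq.
  have -> : ((dot (t *: p + (1 - t) *: q)%R y)%:E - r%:E =
    t%:E * ((dot p y)%:E - r%:E) + (1 - t)%:E * ((dot q y)%:E - r%:E))%E.
    rewrite -!EFinB -!EFinM -EFinD !dot_lin; congr (_%:E); ring.
  by apply: leeD; apply: lee_wpmul2l;
    rewrite ?lee_fin ?subr_ge0 ?(ltW t_gt0) ?(ltW t_lt1).
by rewrite /= leNye.
Qed.

(** Without a minimizer, the open sets where [f] exceeds [f y], for [y] in [K], cover [K]. In a
    finite subcover, the index [y] of least value lies in none of the chosen sets. *)
Lemma compact_lsc_min (R : realType) (T : ptopologicalType)
    (K : set T) (f : T -> \bar R) :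
  K !=set0 -> compact K -> lower_semicontinuous f -> (forall x, f x != -oo%E) ->
  exists2 x, K x & forall y, K y -> (f x <= f y)%E.
Proof.
move=> [x0 Kx0] + /lower_semicontinuousP fo fNy; rewrite compact_cover => cK.
apply: contrapT => nomin.
have [|x Kx|D DK Dcov] := cK T K (fun y => [set x | (f y < f x)%E]).
- move=> y _; case: (f y) (fNy y) => [r _| _|] //.
  rewrite (_ : [set _ | _] = set0); first exact: open0.
  by rewrite -subset0 => x /=; rewrite ltNge leey.
- apply: contrapT => xmin; apply: nomin; exists x => // y Ky.
  by rewrite leNgt; apply/negP => yx; apply: xmin; exists y.
have [y0 Dy0 _] := Dcov _ Kx0.
have [y yD ymin] : exists2 y, y \in D & forall z, z \in D -> (f y <= f z)%E.
  pose y := [arg min_(i < [` Dy0]%fset) f (val i)]%O.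
  exists (val y); first exact: valP.
  rewrite /y; case: arg_minP => // i _ imin z zD.
  exact: (imin [` zD]%fset).
have /Dcov[z zD /=] := set_mem (DK _ yD).
by rewrite ltNge ymin.
Qed.

Lemma mx_norm_coord (R : realType) n m (x : 'M[R]_(n, m)) i j :
  `|x i j| <= `|x|.
Proof.
rewrite [leRHS]/Num.norm /= mx_normrE.
by apply/bigmax_geP; right; exists (i, j).
Qed.

Lemma mx_norm_tr (R : realType) n m (x : 'M[R]_(n, m)) : `|x^T| = `|x|.
Proof.
suff le p q (y : 'M[R]_(p, q)) : `|y^T| <= `|y|.
  by apply/le_anti; rewrite le -{1}[x]trmxK le.
rewrite [leLHS]/Num.norm /= mx_normrE; apply/bigmax_leP; split=> // -[i j] _ /=.
by rewrite mxE mx_norm_coord.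
Qed.

(** The norm here is the maximum norm, so its square is one of the summands of [dot x x]. *)
Lemma sqr_norm_le_dot (R : realType) n (x : 'cV[R]_n) : `|x| ^+ 2 <= dot x x.
Proof.
rewrite dotE; have [->|x0] := eqVneq `|x| 0.
  by rewrite expr0n sumr_ge0 // => i _; rewrite -expr2 sqr_ge0.
have [[i j] /= xij] := mx_norm_neq0 x0.
rewrite [X in X ^+ 2]xij (ord1 j) real_normK ?num_real // (bigD1 i) //=.
by rewrite expr2 lerDl sumr_ge0 // => k _; rewrite -expr2 sqr_ge0.
Qed.

Lemma trmx_continuous (R : realType) n m :
  continuous (@trmx R n m).
Proof.
move=> v W [P vP PW]; exists (fun i j => P j i) => [i j|N NP].
  by have := vP j i; rewrite mxE.
by apply: PW => i j; rewrite mxE.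
Qed.

(** The ball is the image under transposition of a closed bounded set of row vectors, to which
    Heine-Borel applies. *)
Lemma closed_ball_cV_compact (R : realType) n (y0 : 'cV[R]_n) (r : R) :
  compact [set y | `|y - y0| <= r].
Proof.
have trK : trmx @` [set v : 'rV[R]_n | `|v^T - y0| <= r] =
    [set y | `|y - y0| <= r].
  by apply/seteqP; split=> [_ [v vr <-]//|y yr]; exists y^T; rewrite /= ?trmxK.
rewrite -trK; apply: continuous_compact.
  exact/continuous_subspaceT/trmx_continuous.
have cont : continuous (fun v : 'rV[R]_n => `|v^T - y0|).
  move=> v; apply: (@cvg_comp _ _ _ (fun w : 'rV[R]_n => w^T - y0)
    Num.norm _ (nbhs (v^T - y0))); last exact: norm_continuous.
  apply: cvgB; [exact: nbhs_filter|exact: trmx_continuous|].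
  by apply: cvg_cst; exact: nbhs_filter.
apply: bounded_closed_compact; last first.
  have cl := (continuous_closedP (fun v : 'rV[R]_n => `|v^T - y0|)).1 cont.
  exact: (cl _ (@closed_le R r)).
exists (`|y0| + r); split; first exact: num_real.
move=> M rM v /= vr; apply: le_trans (ltW rM).
rewrite -(mx_norm_tr v).
have -> : v^T = y0 + (v^T - y0) by rewrite addrC subrK.
by apply: (le_trans (ler_normD _ _)); rewrite lerD2l.
Qed.

Lemma dot_continuous (R : realType) n (y0 : 'cV[R]_n) :
  continuous (fun y : 'cV[R]_n => dot (y - y0) (y - y0)).
Proof.
under eq_fun do rewrite dotE.
apply: continuous_big => [|i _]; first exact: add_continuous.
have c : continuous (fun z : 'cV[R]_n => (z - y0) i 0).
  under eq_fun do rewrite !mxE.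
  move=> y; apply: cvgB; [exact: nbhs_filter|exact: coord_continuous|].
  by apply: cvg_cst; exact: nbhs_filter.
by move=> y; apply: cvgM; [exact: nbhs_filter|exact: c|exact: c].
Qed.

Lemma lower_semicontinuousD (R : realType) (T : topologicalType)
    (f : T -> \bar R) (q : T -> R) :
  (forall x, f x != -oo%E) -> lower_semicontinuous f -> continuous q ->
  lower_semicontinuous (fun x => f x + (q x)%:E)%E.
Proof.
move=> fNy fl qc x a; rewrite -lteBlDr // => afx.
(* The level [a] is split as [b + (a - b)]: near [x], [f] stays above [b] and [q] above [a - b]. *)
have [b ab bf] : exists2 b, a - q x < b & (b%:E < f x)%E.
  case: (f x) afx (fNy x) => [r| |] //; last first.
    by move=> _ _; exists (a - q x + 1); rewrite ?ltry // ltrDl.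
  rewrite lte_fin => ar _; exists ((a - q x + r) / 2); rewrite ?lte_fin; lra.
have [V Vx Vf] := fl x b bf.
have Wx : nbhs x [set y | a - b < q y].
  by apply: (cvgr_gt (q x) (qc x)); lra.
exists (V `&` [set y | a - b < q y]); first exact: filterI.
move=> y [/Vf bfy /= ab']; rewrite -lteBlDr //; apply: le_lt_trans bfy.
by rewrite lee_fin; lra.
Qed.

(* Minimize [g] plus a steep quadratic centred at a point [y0] of the domain:
   by lower semicontinuity, the minimizer over a small ball around [y0] is
   interior, and a subgradient there gives an affine minorant of [g]. *)
Lemma fenchel_proper (R : realType) n (g : 'cV[R]_n -> \bar R) :
  proper_fun g -> lower_semicontinuous g -> convex_efun g ->
  proper_fun (fenchel g).
Proof.
move=> gprop glsc gconv; split; first by move=> p; exact: fenchel_Ny.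
have [gNy [y0 gy0]] := gprop.
have := gNy y0; move: gy0; case gE : (g y0) => [c| |] // _ _.
have [|V Vy0 Vg] := glsc y0 (c - 1); first by rewrite gE lte_fin; lra.
have [e /= e0 eV] := (nbhs_ballP y0 V).1 Vy0.
pose r := e / 2; have r0 : 0 < r by rewrite divr_gt0.
pose K := [set y | `|y - y0| <= r].
have Ky0 : K y0 by rewrite /K /= subrr normr0 ltW.
have KV y : K y -> ((c - 1)%:E < g y)%E.
  move=> Ky; apply: Vg; apply: eV; rewrite -ball_normE /= distrC.
  by apply: (le_lt_trans Ky); rewrite /r; lra.
(* With this scaling the penalty is at least 1 on the boundary of [K]. As [g > c - 1] on [K] and the
   penalized value at [y0] is [c], the minimizer cannot lie on the boundary. *)
pose B : 'M[R]_n := (2 / r ^+ 2)%:M.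
have Bs : B^T = B by rewrite tr_scalar_mx.
have sqB y : 2^-1 * sqnorm B (y - y0) = r ^- 2 * dot (y - y0) (y - y0).
  rewrite /sqnorm mul_scalar_mx dotZr; field.
  exact: lt0r_neq0.
have lsc : lower_semicontinuous
    (fun y => g y + (r ^- 2 * dot (y - y0)%R (y - y0)%R)%:E)%E.
  apply: lower_semicontinuousD => // y.
  apply: (@cvgMl_tmp _ _ _ (nbhs_filter _)).
  exact: dot_continuous.
have [|y1 Ky1 y1min] := compact_lsc_min (ex_intro _ _ Ky0)
  (@closed_ball_cV_compact R n y0 r) lsc.
  move=> y; rewrite adde_eq_ninfty negb_or gNy //.
have y1fin := y1min _ Ky0.
rewrite gE subrr dot0r mulr0 adde0 in y1fin.
have gy1 := KV _ Ky1.
case g1E : (g y1) y1fin gy1 => [c1| |] //.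
rewrite -EFinD lee_fin lte_fin => y1fin gy1.
have y1int : `|y1 - y0| < r.
  rewrite -(ltr_pXn2r (n := 2)) // ?nnegrE ?normr_ge0 ?ltW //.
  apply: le_lt_trans (sqr_norm_le_dot _) _.
  rewrite -[ltRHS]mulr1 -ltr_pdivrMl ?exprn_gt0 //; lra.
have sub : subdiff g y1 (B *m (y0 - y1)).
  apply: local_min_subdiff => //; first by rewrite g1E.
  move=> y; have y1_gt0 : 0 < 1 + `|y - y1| by rewrite ltr_pwDl.
  (* Up to this length the segment from [y1] towards [y] stays in [K]; the summand 1 keeps the
     denominator positive when [y = y1]. *)
  exists ((r - `|y1 - y0|) / (1 + `|y - y1|)); first by rewrite divr_gt0 ?subr_gt0.
  move=> t t0; rewrite ltr_pdivlMr // => tr.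
  rewrite !sqB; apply: y1min; rewrite /K /=.
  rewrite addrAC; apply: (le_trans (ler_normD _ _)); rewrite normrZ gtr0_norm //.
  by move: tr; rewrite mulrDr mulr1; lra.
(* For a subgradient [p] at [y1], every [<p, y> - g y] is at most [<p, y1> - g y1], so the conjugate
   is finite at [p]. *)
exists (B *m (y0 - y1)); set p := B *m _.
suff : (fenchel g p <= (dot p y1 - c1)%:E)%E by case: (fenchel g p).
apply: ge_ereal_sup => _ [y _ <-].
have := sub y; rewrite -/p g1E; case: (g y) (gNy y) => [s _| _|] //.
  by rewrite -!EFinD !lee_fin !dot_lin; lra.
by rewrite /= leNye.
Qed.

(** * The schemes as generalized proximal point steps *)

Lemma coordD (R : realType) n (u v : 'cV[R]_n) i :
  (u + v) i 0 = u i 0 + v i 0.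
Proof. by rewrite mxE. Qed.

Lemma coordN (R : realType) n (u : 'cV[R]_n) i : (- u) i 0 = - u i 0.
Proof. by rewrite mxE. Qed.

Lemma coordZ (R : realType) n a (u : 'cV[R]_n) i : (a *: u) i 0 = a * u i 0.
Proof. by rewrite mxE. Qed.

Lemma coord0 (R : realType) n i : (0 : 'cV[R]_n) i 0 = 0.
Proof. by rewrite mxE. Qed.

Definition coordE := (coord0, coordD, coordN, coordZ).

Lemma pds_step_inclusion s (R : realType) n m
    (f : 'cV[R]_n -> \bar R) (g : 'cV[R]_m -> \bar R) (A : 'M[R]_(m, n))
    (M : 'M[R]_n) (G : 'M[R]_m) (c ct c1 : 'cV[R]_(n + m)) :
  proper_fun f -> convex_efun f -> proper_fun (fenchel g) ->
  convex_efun (fenchel g) -> posdefmx M -> posdefmx G ->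
  pds_step s f g A M G (usubmx c) (dsubmx c) (usubmx ct) (dsubmx ct)
    (usubmx c1) (dsubmx c1) ->
  [/\ f (usubmx ct) \is a fin_num, fenchel g (dsubmx ct) \is a fin_num,
      pd_operator f g A ct (- (pds_Q s A M G *m (ct - c)))
    & c1 = c + pds_M s A M G *m (ct - c)].
Proof.
move=> fp fc gp gc Mp Gp.
rewrite -(vsubmxK c) -(vsubmxK ct) -(vsubmxK c1) !col_mxKu !col_mxKd.
move: (usubmx c) (dsubmx c) (usubmx ct) (dsubmx ct) (usubmx c1) (dsubmx c1).
move=> x p xt pt x1 p1 /=.
have Ma := mulM_a A Mp; have Gb := mulG_b A Gp.
(* The optimality conditions are extracted once, for arbitrary prox centres [xu] and [pu]. Each
   scheme then owes only two vector identities. *)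
have K xu pu w z : prox f M xu xt -> prox (fenchel g) G pu pt ->
    col_mx (M *m (xu - xt) + A^T *m pt) (- A *m xt + G *m (pu - pt)) = w ->
    col_mx x1 p1 = z ->
  [/\ f xt \is a fin_num, fenchel g pt \is a fin_num,
      pd_operator f g A (col_mx xt pt) w & col_mx x1 p1 = z].
  move=> /(prox_subdiff fp fc (posdefmx_sym Mp))[ffin fsub].
  move=> /(prox_subdiff gp gc (posdefmx_sym Gp))[gfin gsub] <- <-; split => //.
  rewrite /pd_operator /= col_mxKu col_mxKd.
  by exists (M *m (xu - xt)) => //; exists (G *m (pu - pt)).
have E := (mulmxDr, mulmxDl, mulNmx, mulmxN, mul1mx, mul0mx, =^~ mulmxA,
  =^~ scalemxAr, Ma, Gb).
move: K Ma Gb E; rewrite opp_col_mx add_col_mx /pds_step /pds_Q /pds_M.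
(* From here on the inverses enter only through [M a = A^T] and [G b = A], and the identities can be
   checked coordinatewise by [ring]. *)
move: (invmx M *m A^T) (invmx G *m A) => a b K Ma Gb E.
case: s => -[H1 H2 ? ?]; subst;
  first [apply: (K _ _ _ _ H1 H2) | apply: (K _ _ _ _ H2 H1)];
  rewrite ?mul_block_col ?mul1mx ?opp_col_mx ?add_col_mx; congr col_mx; apply/colP => i;
  rewrite ?E ?addr0 ?add0r !coordE; ring.
Qed.

Lemma subdiff_fin_num (R : realType) n (f : 'cV[R]_n -> \bar R) x u :
  proper_fun f -> subdiff f x u -> f x \is a fin_num.
Proof.
move=> [fNy [y fy]] fu; rewrite fin_numE fNy /=; apply/eqP => fx.
by have := fu y; rewrite fx addye // leye_eq (negPf fy).
Qed.

(* Add the two subgradient inequalities; the skew part of the operator turns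
   into the bilinear terms of the Lagrangian. *)
Lemma pd_operator_lagrangian (R : realType) n m (f : 'cV[R]_n -> \bar R)
    (g : 'cV[R]_m -> \bar R) (A : 'M[R]_(m, n)) (x x' : 'cV[R]_n)
    (p p' : 'cV[R]_m) (w : 'cV[R]_(n + m)) (a a' b b' : R) :
  pd_operator f g A (col_mx x p) w ->
  f x = a%:E -> f x' = a'%:E -> fenchel g p = b%:E -> fenchel g p' = b'%:E ->
  a + dot p' (A *m x) - b' - (a' + dot p (A *m x') - b) <=
  dot (col_mx x' p' - col_mx x p) (- w).
Proof.
move=> [u /= su [v sv <-]] fx fx' gp gp'.
move: su sv; rewrite !col_mxKu !col_mxKd => /(_ x') + /(_ p').
rewrite fx fx' gp gp' !lee_fin opp_col_mx add_col_mx opp_col_mx dot_col_mx.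
by rewrite mulNmx !dot_lin !dot_tr !(dotC u) !(dotC v); lra.
Qed.

(** * Averaged iterates and the telescoped gap estimate *)

Lemma average_col_mx (R : realType) n m (c : nat -> 'cV[R]_(n + m)) k :
  average c k = col_mx (average (usubmx \o c) k) (average (dsubmx \o c) k).
Proof.
rewrite /average -scale_col_mx; congr (_ *: _).
elim/big_rec3: _ => [|i x p d _ ->]; first by rewrite col_mx0.
by rewrite -add_col_mx vsubmxK.
Qed.

Lemma dot_average (R : realType) n (q : 'cV[R]_n) x k :
  dot q (average x k) = k%:R^-1 * \sum_(0 <= i < k) dot q (x i).
Proof.
rewrite /average dotZr; congr (_ * _).
by elim/big_rec2 : _ => [|i a b _ <-]; rewrite ?dot0r ?dotDr.
Qed.

Lemma convex_average_fin_num (R : realType) n (f : 'cV[R]_n -> \bar R)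
    (x : nat -> 'cV[R]_n) k : (0 < k)%N -> (forall y, f y != -oo%E) ->
  convex_efun f -> (forall i, f (x i) \is a fin_num) ->
  f (average x k) \is a fin_num /\
  fine (f (average x k)) <= k%:R^-1 * \sum_(0 <= i < k) fine (f (x i)).
Proof.
move=> k0 fNy fconv ffin.
have := @convex_average R n f x (fine \o f \o x) k k0 fconv.
have fle i : (i < k)%N -> (f (x i) <= (fine (f (x i)))%:E)%E by rewrite fineK.
move=> /(_ (fun i => fle i)).
by have := fNy (average x k); case: (f (average x k)) => // r _; rewrite lee_fin.
Qed.

Section pds_gap.
Variables (s : pds) (R : realType) (n m : nat).
Variables (f : 'cV[R]_n -> \bar R) (g : 'cV[R]_m -> \bar R) (A : 'M[R]_(m, n)).
Hypotheses (f_proper : proper_fun f) (f_convex : convex_efun f).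
Hypotheses (gs_proper : proper_fun (fenchel g)).
Hypotheses (gs_convex : convex_efun (fenchel g)).
Variables (M : 'M[R]_n) (G : 'M[R]_m).
Hypotheses (M_posdef : posdefmx M) (G_posdef : posdefmx G).
Hypothesis MG_posdef : posdefmx (M - A^T *m invmx G *m A).
Variables (c ct : nat -> 'cV[R]_(n + m)).
Hypothesis c_generated : pds_generated s f g A M G c ct.
Variables (k : nat) (k_ge1 : (1 <= k)%N).

Let xt i := usubmx (ct i).
Let pt i := dsubmx (ct i).
Let F := fine (f (average xt k)).
Let H := fine (fenchel g (average pt k)).

Let incl i := pds_step_inclusion f_proper f_convex gs_proper gs_convex
  M_posdef G_posdef (c_generated i).

Lemma average_fine :
  [/\ f (average xt k) = F%:E, fenchel g (average pt k) = H%:E,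
      F <= k%:R^-1 * \sum_(0 <= i < k) fine (f (xt i)) &
      H <= k%:R^-1 * \sum_(0 <= i < k) fine (fenchel g (pt i))].
Proof.
have fx i : f (xt i) \is a fin_num by have [] := incl i.
have gp i : fenchel g (pt i) \is a fin_num by have [] := incl i.
have [Ff FE] := convex_average_fin_num k_ge1 f_proper.1 f_convex fx.
have [Hf HE] := convex_average_fin_num k_ge1 gs_proper.1 gs_convex gp.
by rewrite /F /H !fineK.
Qed.

(** The bracket is [L(xt_i, p') - L(x', pt_i)], arranged so that summing over [i] separates its
    terms. *)
Lemma pds_step_gap i (x' : 'cV[R]_n) (p' : 'cV[R]_m) (a' b' : R) :
  f x' = a'%:E -> fenchel g p' = b'%:E ->
  2 * (fine (f (xt i)) + fine (fenchel g (pt i))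
       + (dot p' (A *m xt i) - dot (A *m x') (pt i)) - (a' + b')) <=
  sqnorm (pds_S s A M G) (c i - col_mx x' p')
  - sqnorm (pds_S s A M G) (c i.+1 - col_mx x' p').
Proof.
move=> fx' gp'; have [fx gp op ->] := incl i.
move: op; rewrite -[X in pd_operator _ _ _ X](vsubmxK (ct i)) => op.
have := pd_operator_lagrangian op (esym (fineK fx)) fx' (esym (fineK gp)) gp'.
rewrite vsubmxK opprK -/(xt i) -/(pt i) (dotC (A *m x')).
have := pds_three_point M_posdef G_posdef MG_posdef s (c i) (col_mx x' p') (ct i - c i).
by rewrite [c i + (ct i - c i)]addrC subrK; lra.
Qed.

Lemma pds_average_gap (x' : 'cV[R]_n) (p' : 'cV[R]_m) (a' b' : R) :
  f x' = a'%:E -> fenchel g p' = b'%:E ->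
  F + dot p' (A *m average xt k) - b' - (a' + dot (average pt k) (A *m x') - H)
  <= (2 * k%:R)^-1 * sqnorm (pds_S s A M G) (c 0%N - col_mx x' p').
Proof.
move=> fx' gp'; have [_ _ FE HE] := average_fine.
have k0 : (0 : R) < k%:R by rewrite ltr0n.
rewrite -dot_tr !(dotC (average _ _)) !dot_average.
set S := pds_S s A M G; set c' := col_mx x' p'.
have : \sum_(0 <= i < k) 2 * (fine (f (xt i)) + fine (fenchel g (pt i))
       + (dot (A^T *m p') (xt i) - dot (A *m x') (pt i)) - (a' + b')) <=
    sqnorm S (c 0%N - c').
  (* The sum telescopes to these two end terms, and the last one is dropped because [S] is positive
     semidefinite. *)
  apply: (@le_trans _ _ (sqnorm S (c 0%N - c') - sqnorm S (c k - c'))).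
    rewrite -opprB -(@telescope_sumr _ 0 k (fun i => sqnorm S (c i - c'))) //.
    rewrite -sumrN; apply: ler_sum => i _; rewrite opprB.
    by have := pds_step_gap i fx' gp'; rewrite -(dot_tr A) (dotC (xt i)).
  by rewrite lerBlDr lerDl pds_S_ge0.
rewrite -mulr_sumr !sumrB 2!big_split /= sumrB sumr_const_nat subn0 -[_ *+ k]mulr_natl.
move: FE HE; move: (\sum_(_ <= _ < _) _) (\sum_(_ <= _ < _) _).
move: (\sum_(_ <= _ < _) _) (\sum_(_ <= _ < _) _) => Y X SG SF.
move=> FE HE; rewrite -(ler_pM2l (x := (2 * k%:R)^-1)) ?invr_gt0 ?mulr_gt0 //.
apply: le_trans.
have -> : (2 * k%:R)^-1 * (2 * (SF + SG + (X - Y) - k%:R * (a' + b'))) =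
    k%:R^-1 * SF + k%:R^-1 * SG + k%:R^-1 * X - k%:R^-1 * Y - (a' + b').
  by field; rewrite lt0r_neq0.
by lra.
Qed.

End pds_gap.

(** * Saddle points and the restricted primal-dual gap *)

(** The saddle point inequality: [pd_operator_lagrangian] at [c'] with the operator value
    [w = 0]. *)
Lemma zer_lagrangian_ge (R : realType) n m (f : 'cV[R]_n -> \bar R)
    (g : 'cV[R]_m -> \bar R) (A : 'M[R]_(m, n)) (c' : 'cV[R]_(n + m))
    (x : 'cV[R]_n) (p : 'cV[R]_m) (a b : R) :
  proper_fun f -> proper_fun (fenchel g) -> zer (pd_operator f g A) c' ->
  f x = a%:E -> fenchel g p = b%:E ->
  exists a' b' : R, [/\ f (usubmx c') = a'%:E, fenchel g (dsubmx c') = b'%:E &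
    0 <= a + dot (dsubmx c') (A *m x) - b'
         - (a' + dot p (A *m usubmx c') - b)].
Proof.
move=> fp gp zc fx px.
have [u /(subdiff_fin_num fp)/fineK/esym fu] := zc.
move=> [v /(subdiff_fin_num gp)/fineK/esym gv _].
exists (fine (f (usubmx c'))), (fine (fenchel g (dsubmx c'))); split => //.
move: zc; rewrite /zer /= -[X in pd_operator _ _ _ X](vsubmxK c') => zc.
have := pd_operator_lagrangian zc fu fx gv px.
rewrite oppr0 dot0r; lra.
Qed.

Lemma pd_gap_le (R : realType) n m (f : 'cV[R]_n -> \bar R)
    (g : 'cV[R]_m -> \bar R) (A : 'M[R]_(m, n)) (B1 : set 'cV[R]_n)
    (B2 : set 'cV[R]_m) (c : 'cV[R]_(n + m)) (a b K : R) :
  f (usubmx c) = a%:E -> fenchel g (dsubmx c) = b%:E ->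
  (forall x, f x != -oo%E) -> (forall p, fenchel g p != -oo%E) ->
  B1 !=set0 ->
  (forall x' p' a' b', B1 x' -> B2 p' -> f x' = a'%:E -> fenchel g p' = b'%:E ->
     a + dot p' (A *m usubmx c) - b' - (a' + dot (dsubmx c) (A *m x') - b) <= K) ->
  (pd_gap f g A B1 B2 c <= K%:E)%E.
Proof.
move=> fx gp fNy gNy [x0 Bx0] le; rewrite /pd_gap.
set s := ereal_sup _; set i := ereal_inf _.
(* In this form the bound can be checked pair by pair. Where the conjugate is [+oo] the Lagrangian
   in the supremum is [-oo], and where [f x'] is [+oo] the one in the infimum is [+oo]. *)
have : (s <= i + K%:E)%E.
  rewrite -leeBlDr //; apply: le_ereal_inf_tmp => _ [x' Bx' <-].
  rewrite leeBlDr //; apply: ge_ereal_sup => _ [p' Bp' <-].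
  rewrite /lagrangian fx gp.
  have := gNy p'; case gp' : (fenchel g p') => [b'| |] // _; last first.
    by rewrite -EFinD /= leNye.
  have := fNy x'; case fx' : (f x') => [a'| |] // _; last first.
    by rewrite !addye // leey.
  by rewrite -!EFinD lee_fin; have := le _ _ _ _ Bx' Bp' fx' gp'; lra.
case: i => [r| |].
- by rewrite leeBlDr // addeC.
- by rewrite /= addeNy leNye.
(* Here [s] is also [-oo], and the gap is [-oo] by the convention for opposite infinities. *)
- by rewrite addNye leeNy_eq => /eqP ->; rewrite addNye leNye.
Qed.

Theorem corollary3 (R : realType) (n m : nat)
    (f : 'cV[R]_n -> \bar R) (g : 'cV[R]_m -> \bar R) (A : 'M[R]_(m, n))
    (f_proper : proper_fun f) (f_lsc : lower_semicontinuous f)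
    (f_convex : convex_efun f)
    (g_proper : proper_fun g) (g_lsc : lower_semicontinuous g)
    (g_convex : convex_efun g)
    (M : 'M[R]_n) (G : 'M[R]_m)
    (M_posdef : posdefmx M) (G_posdef : posdefmx G)
    (MG_posdef : posdefmx (M - A^T *m invmx G *m A))
    (s : pds) (c ct : nat -> 'cV[R]_(n + m))
    (c_generated : pds_generated s f g A M G c ct)
    (B1 : set 'cV[R]_n) (B2 : set 'cV[R]_m)
    (B_bounded : bounded_set (prodset B1 B2))
    (k : nat) (k_ge1 : (1 <= k)%N) :
  (pd_gap f g A B1 B2 (average ct k)
     <= ((2 * k%:R)^-1)%:E
        * ereal_sup [set (sqnorm (pds_S s A M G) (c 0%N - c')%R)%:E
                       | c' in prodset B1 B2])%E
  /\ ((exists c', prodset B1 B2 c' /\ zer (pd_operator f g A) c') ->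
      (0 <= pd_gap f g A B1 B2 (average ct k))%E).
Proof.
have gs_proper := fenchel_proper g_proper g_lsc g_convex.
have gs_convex := fenchel_convex g_proper.
have [fF gH _ _] := average_fine f_proper f_convex gs_proper gs_convex
  M_posdef G_posdef c_generated k_ge1.
have gap := pds_average_gap f_proper f_convex gs_proper gs_convex
  M_posdef G_posdef MG_posdef c_generated k_ge1.
move: fF gH gap; set F := fine (f _); set H := fine (fenchel _ _).
rewrite (average_col_mx ct).
set xa := average (usubmx \o ct) k; set pa := average (dsubmx \o ct) k.
rewrite -/xa -/pa => fF gH gap; split.
- have k_gt0 : 0 < (2 * k%:R)^-1 :> R by rewrite invr_gt0 mulr_gt0 ?ltr0n.
  (* If [B1] or [B2] is empty, its infimum is [+oo] or its supremum [-oo], and the gap is [-oo]. *)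
  have [->|/set0P[x0 Bx0]] := eqVneq B1 set0.
    by rewrite /pd_gap image_set0 ereal_inf0 /= addeNy leNye.
  have [->|/set0P[p0 Bp0]] := eqVneq B2 set0.
    by rewrite /pd_gap image_set0 ereal_sup0 /= addNye leNye.
  have sup_ge x' p' : B1 x' -> B2 p' -> ((sqnorm (pds_S s A M G)
      (c 0%N - col_mx x' p')%R)%:E <= ereal_sup [set (sqnorm (pds_S s A M G)
      (c 0%N - c')%R)%:E | c' in prodset B1 B2])%E.
    move=> Bx' Bp'; apply: ereal_sup_ubound; exists (col_mx x' p') => //.
    by rewrite /prodset /= col_mxKu col_mxKd.
  (* A supremum [+oo] makes the bound trivial, and [-oo] is excluded by the point [(x0, p0)]. *)
  move: sup_ge; case: (ereal_sup _) => [e| |] sup_ge.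
  + rewrite -EFinM; apply: (pd_gap_le (a := F) (b := H)).
    * by rewrite col_mxKu.
    * by rewrite col_mxKd.
    * exact: f_proper.1.
    * exact: gs_proper.1.
    * by exists x0.
    move=> x' p' a' b' Bx' Bp' fx' gp'; rewrite col_mxKu col_mxKd.
    apply: le_trans (gap _ _ _ _ fx' gp') _.
    by rewrite ler_pM2l // -lee_fin sup_ge.
  + by rewrite gt0_muley ?lte_fin // leey.
  + by have := sup_ge _ _ Bx0 Bp0.
- move=> [c' [[Bx' Bp'] zc']].
  have [a' [b' [fx' gp' ge0]]] := zer_lagrangian_ge f_proper gs_proper zc' fF gH.
  (* The saddle point competes in both the supremum and the infimum, so the gap is at least this
     difference, which the saddle inequality makes nonnegative. *)
  apply: (@le_trans _ _ (lagrangian f g A xa (dsubmx c')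
                         - lagrangian f g A (usubmx c') pa)%E).
    by rewrite /lagrangian fF gH fx' gp' -!EFinD lee_fin.
  rewrite /pd_gap col_mxKu col_mxKd; apply: leeB.
  + by apply: ereal_sup_ubound; exists (dsubmx c').
  + by apply: ereal_inf_lbound; exists (usubmx c').
Qed.
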